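(* Let $u$ be a $\mathfrak{c}$-saturated ultrafilter on $\omega$. Then $\mathbb{I}_u$ is a universal continuum of weight $\mathfrak{c}$: it is a continuum of weight $\mathfrak{c}$ and it maps continuously onto every continuum of weight $\mathfrak{c}$ or less.
   Context: A continuum is a (nonempty) compact connected Hausdorff space. The weight of a space is the least cardinality of a base for its topology, and $\mathfrak{c}=2^{\aleph_0}$. Let $\mathbb{I}=[0,1]$ and $\mathbb{M}=\omega\times\mathbb{I}$ ($\omega$ discrete). For a nonprincipal ultrafilter $u$ on $\omega$ put $\mathbb{I}_u=\bigcap_{U\in u}\operatorname{cl}(U\times\mathbb{I})$, closures being taken in the Čech–Stone compactification $\beta\mathbb{M}$. A (necessarily nonprincipal) ultrafilter $u$ on $\omega$ is $\mathfrak{c}$-saturated if for every countable structure $A$ (for a countable first-order language) the ultrapower $A^\omega/u$ is a $\mathfrak{c}$-saturated structure, i.e., every set of formulas in one free variable with fewer than $\mathfrak{c}$ parameters from the ultrapower that is finitely satisfiable in it is satisfied by a single element. *)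

(* Defs.v *)
From HB Require Import structures.
From mathcomp Require Import all_boot all_order all_algebra.
From mathcomp Require Import all_classical all_reals.
From mathcomp Require Import topology.
Import numFieldTopology.Exports.

Set Implicit Arguments.
Unset Strict Implicit.
Unset Printing Implicit Defensive.

Local Open Scope classical_set_scope.
Local Open Scope card_scope.

Definition card_lt T U (A : set T) (B : set U) : Prop :=
  (A #<= B) /\ ~ (B #<= A).

(* A set whose cardinality is 2 ^ aleph_0. *)
Definition continuum_card : set (nat -> bool) := [set: nat -> bool].

(* The least cardinality of a base of X is that of K. *)
Definition weight_eq (X : topologicalType) U (K : set U) : Prop :=
  (exists2 B : set (set X), basis B & B #= K) /\
  (forall B : set (set X), basis B -> K #<= B).

Definition weight_le (X : topologicalType) U (K : set U) : Prop :=
  exists2 B : set (set X), basis B & B #<= K.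

Definition continuum (X : topologicalType) : Prop :=
  [/\ [set: X] !=set0, compact [set: X], connected [set: X] & hausdorff_space X].

Section StoneCech.
Variables (R : realType) (X : topologicalType).

Definition unit_interval : topologicalType :=
  set_type (`[0%R, 1%R]%classic : set R).

Definition cube : topologicalType :=
  prod_topology (fun _ : continuousType X unit_interval => unit_interval).

Definition cube_eval (x : X) : cube := fun f => f x.

Definition stone_cech : topologicalType := set_type (closure (range cube_eval)).

Lemma cube_eval_closure (x : X) : cube_eval x \in closure (range cube_eval).
Proof. by apply: mem_set; apply: subset_closure; exists x. Qed.

(* The canonical map, which is an embedding when X is Tychonoff. *)
Definition stone_cech_unit (x : X) : stone_cech :=
  exist _ (cube_eval x) (cube_eval_closure x).

End StoneCech.

Section StandardSubcontinuum.
Variable R : realType.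

(* The topology of nat is the discrete one. *)
Definition MM : topologicalType := (nat * unit_interval R)%type.

Definition II_set (u : set_system nat) : set (stone_cech R MM) :=
  \bigcap_(U in u) closure (@stone_cech_unit R MM @` (U `*` setT)).

Definition II (u : set_system nat) : topologicalType := set_type (II_set u).

End StandardSubcontinuum.

Record language := Language {
  fun_symbol : Type;
  fun_arity : fun_symbol -> nat;
  rel_symbol : Type;
  rel_arity : rel_symbol -> nat }.

Definition countable_language (L : language) : Prop :=
  countable [set: fun_symbol L] /\ countable [set: rel_symbol L].

Record structure (L : language) := Structure {
  carrier :> Type;
  carrier_inhabited : inhabited carrier;
  fun_interp : forall f : fun_symbol L, ('I_(fun_arity f) -> carrier) -> carrier;
  rel_interp : forall r : rel_symbol L, ('I_(rel_arity r) -> carrier) -> Prop }.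

(* Terms and formulas with parameters from P, that is, over the language L
   expanded by one constant for each element of P. *)
Inductive term (L : language) (P : Type) :=
| Var of nat
| Par of P
| App (f : fun_symbol L) of ('I_(fun_arity f) -> term L P).

Inductive formula (L : language) (P : Type) :=
| Eq of term L P & term L P
| Rel (r : rel_symbol L) of ('I_(rel_arity r) -> term L P)
| Bot
| Imp of formula L P & formula L P
| All of nat & formula L P.

Arguments Var {L P}.
Arguments Par {L P}.
Arguments Bot {L P}.

Section Semantics.
Variables (L : language) (P : Type).

Fixpoint term_vars (t : term L P) : set nat :=
  match t with
  | Var n => [set n]
  | Par _ => set0
  | App _ ts => [set n | exists i, term_vars (ts i) n]
  end.

Fixpoint free_vars (phi : formula L P) : set nat :=
  match phi with
  | Eq s t => term_vars s `|` term_vars t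
  | Rel _ ts => [set n | exists i, term_vars (ts i) n]
  | Bot => set0
  | Imp p q => free_vars p `|` free_vars q
  | All n p => free_vars p `\ n
  end.

Variables (M : structure L) (c : P -> M).

Fixpoint eval (v : nat -> M) (t : term L P) : M :=
  match t with
  | Var n => v n
  | Par p => c p
  | App _ ts => fun_interp (fun i => eval v (ts i))
  end.

Fixpoint satisfies (v : nat -> M) (phi : formula L P) : Prop :=
  match phi with
  | Eq s t => eval v s = eval v t
  | Rel _ ts => rel_interp (fun i => eval v (ts i))
  | Bot => False
  | Imp p q => satisfies v p -> satisfies v q
  | All n p => forall a, satisfies (fun m => if m == n then a else v m) p
  end.

End Semantics.

(* The one free variable is the variable 0, so that the constant valuation
   at a interprets it by a. *)
Definition saturated (L : language) (M : structure L) U (K : set U) : Prop :=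
  forall (P : set M) (S : set (formula L P)),
    card_lt P K ->
    (forall phi, S phi -> free_vars phi `<=` [set 0%N]) ->
    (forall F : set (formula L P), finite_set F -> F `<=` S ->
       exists a : M, forall phi, F phi -> satisfies set_val (fun=> a) phi) ->
    exists a : M, forall phi, S phi -> satisfies set_val (fun=> a) phi.

Section Ultrapower.
Variables (L : language) (A : structure L).
Variables (u : set_system nat) (uF : ProperFilter u).

Definition ultra_eq (f g : {classic nat -> A}) : bool :=
  `[< u [set n | f n = g n] >].

Lemma ultra_eq_refl : reflexive ultra_eq.
Proof. by move=> f; apply/asboolP; apply: filterE. Qed.

Lemma ultra_eq_sym : symmetric ultra_eq.
Proof. by move=> f g; apply/asboolP/asboolP; apply: filterS => n /= ->. Qed.

Lemma ultra_eq_trans : transitive ultra_eq.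
Proof.
move=> g f h /asboolP fg /asboolP gh; apply/asboolP.
by apply: filterS2 fg gh => n /= -> ->.
Qed.

Definition ultra_equiv : equiv_rel {classic nat -> A} :=
  EquivRel ultra_eq ultra_eq_refl ultra_eq_sym ultra_eq_trans.

Definition ultra_carrier : Type := {eq_quot ultra_equiv}%qT.

Definition ultra_class (f : nat -> A) : ultra_carrier :=
  (\pi_({eq_quot ultra_equiv}) (f : {classic nat -> A}))%qT.

Definition ultra_repr (x : ultra_carrier) : nat -> A :=
  repr (x : {eq_quot ultra_equiv}%qT).

Lemma ultra_inhabited : inhabited ultra_carrier.
Proof. by case: (carrier_inhabited A) => a; split; exact: ultra_class (fun=> a). Qed.

(* The operations and relations are given on the chosen representatives of the
   classes; since u is a filter, they do not depend on that choice. *)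
Definition ultrapower : structure L := {|
  carrier := ultra_carrier;
  carrier_inhabited := ultra_inhabited;
  fun_interp := fun f xs =>
    ultra_class (fun n => fun_interp (fun i => ultra_repr (xs i) n));
  rel_interp := fun r xs =>
    u [set n | rel_interp (fun i => ultra_repr (xs i) n)] |}.

End Ultrapower.

Definition continuum_saturated_ultrafilter (u : set_system nat) : Prop :=
  exists uU : UltraFilter u,
    forall (L : language) (A : structure L),
      countable_language L -> countable [set: A] ->
      saturated (ultrapower A (@ultra_proper _ _ uU)) continuum_card.

(* Main.v *)
Require Import Defs.
From mathcomp Require Import all_boot all_order all_algebra.
From mathcomp Require Import all_classical all_reals wochoice.
From mathcomp Require Import topology normedtype.
From mathcomp Require Import ring lra.
Import Order.TTheory GRing.Theory Num.Theory.
Import numFieldNormedType.Exports.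

(** A continuum Y of weight at most the continuum is embedded in a cube by a
    family phi of at most continuum many Urysohn functions, and a map of the
    standard subcontinuum into the cube is given by a family of coordinates.  It
    suffices to choose the coordinates so that the image of the map is exactly
    that of phi.

    A coordinate comes from a sequence b i of polygonal functions on the unit
    interval with rational vertices: these form a continuous function on the
    countable sum of intervals, and hence on the Stone-Cech compactification.
    Whether the image is right is decided by countably many kinds of conditions
    on finitely many coordinates, namely that the path in a finite-dimensional
    cube that they describe meets, or misses, a given closed rational box for
    u-almost all n ([box_system], [coordinates_in_image],
    [image_in_coordinates]).  Finitely many of these conditions can be met by a
    single path, since the projection of Y to a finite-dimensional cube is
    compact and connected: a polygon through the points of a fine chain in Y has
    the required properties ([box_system_satisfiable]).

    It remains to satisfy all the conditions at once, in continuum many unknowns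
    b i, in the ultrapower of the countable set of polygons.  This is the
    universality of saturated structures ([realize_conditions]).  The unknowns
    are well-ordered so that each has fewer than continuum many predecessors
    ([short_well_order]), and they are determined one after the other; the
    inductive hypothesis is that for each finite part of the system there are,
    for u-almost all n, values of the later unknowns that satisfy it.  That
    hypothesis consists of positive primitive formulas in the unknowns already
    determined, and c-saturation preserves it when one more is chosen
    ([compatible_step]).  The quantifiers are hidden in the symbols of a countable
    language made for the purpose, so that all formulas used are atomic.

    The standard subcontinuum is connected because a separation would split a set
    of intervals in u into two parts of which only one can be in u
    ([II_connected]).  Its weight is at most the continuum because there are only
    that many continuous functions on the sum of the intervals, and at least the
    continuum because the dyadic intervals along the branches of the binary tree
    give continuum many disjoint nonempty open sets ([cell_disjoint]). *)

Set Implicit Arguments.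
Unset Strict Implicit.
Unset Printing Implicit Defensive.

Local Open Scope classical_set_scope.
Local Open Scope card_scope.

(** * Short well-orders *)

Definition strict_well_order T (lt : T -> T -> Prop) : Prop :=
  [/\ well_founded lt, (forall x y z, lt x y -> lt y z -> lt x z) &
      forall x y, [\/ lt x y, x = y | lt y x]].

Lemma strict_well_order_exists T : exists lt : T -> T -> Prop, strict_well_order lt.
Proof.
have [r rwo] := well_ordering_principle {classic T}.
have rwo' : wo_chain r predT by move=> A _; exact: rwo.
have rxx x : r x x by exact: (wo_chain_reflexive rwo').
have ranti x y : r x y && r y x -> x = y.
  by exact: (wo_chain_antisymmetric rwo').
have rtot x y : r x y || r y x by exact: (wo_chainW rwo').
have rmin (A : set {classic T}) : A !=set0 -> exists2 z, A z & forall x, A x -> r z x.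
  move=> [x Ax]; have [|z [[zA zmin] _]] := rwo [pred x | `[< A x >]].
    by exists x; apply/asboolP.
  exists z; first by move/asboolP: zA.
  by move=> y Ay; apply: zmin; apply/asboolP.
exists (fun x y : {classic T} => ~~ r y x); split.
- move=> x; apply: contrapT => nx.
  have [z nz zmin] := rmin [set z | ~ Acc (fun x y : {classic T} => ~~ r y x) z]
    (ex_intro _ x nx).
  apply: nz; constructor => y ryz; apply: contrapT => /zmin.
  exact/negP.
- move=> x y z nyx nzy; apply/negP => rzx.
  have [w /= Aw wmin] := rmin [set x; y; z]
    (ex_intro _ x (or_introl (or_introl erefl))).
  have := wmin x (or_introl (or_introl erefl)).
  have := wmin y (or_introl (or_intror erefl)).
  have := wmin z (or_intror erefl).
  case: Aw => [[]|] -> rz ry rx.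
  + have e := ranti x z; rewrite rz rzx in e.
    by move: nzy; rewrite -e // ry.
  + by rewrite rx in nyx.
  + by rewrite ry in nzy.
- move=> x y; have [rxy|nrxy] := boolP (r x y); last exact: Or33.
  have [ryx|nryx] := boolP (r y x); last exact: Or31.
  by apply: Or32; apply: ranti; rewrite rxy.
Qed.

Lemma strict_well_order_pullback T U (j : T -> U) lt : injective j ->
  strict_well_order lt -> strict_well_order (fun x y => lt (j x) (j y)).
Proof.
move=> jinj [wf tr tri]; split.
- move=> x; have [y] : exists y, y = j x by exists (j x).
  elim/(well_founded_ind wf): y x => y IH x yE.
  by constructor => z; rewrite -yE => /IH; apply.
- by move=> x y z; exact: tr.
- move=> x y; case: (tri (j x) (j y)) => [?|/jinj ?|?];
    by [apply: Or31|apply: Or32|apply: Or33].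
Qed.

Lemma inj_set_card_le T U (A : set T) (B : set U) (f : T -> U) :
  {in A &, injective f} -> f @` A `<=` B -> A #<= B.
Proof.
move=> finj /subset_card_le; apply: card_le_trans.
by have := inj_card_eq finj; rewrite card_eq_sym => /card_eqPle [].
Qed.

Lemma card_leT_inj T U (B : set U) : [set: T] #<= B ->
  exists2 f : T -> U, injective f & forall x, B (f x).
Proof.
move=> /card_leP [f]; pose g (x : T) := f (exist _ x (mem_setT x)).
exists (fun x => set_val (g x)); last by move=> x; exact: set_mem (valP (g x)).
move=> x y /val_inj /(@inj _ _ _ f) e.
by have := congr1 val (e (mem_set I) (mem_set I)).
Qed.

(** If some initial segment of a well-order of the continuum is as large as the
    whole, then the order of the least such segment is pulled back along an
    injection of the whole into it; all proper segments of that one are smaller. *)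
Lemma short_well_order T (j : T -> nat -> bool) : injective j ->
  exists2 lt : T -> T -> Prop, strict_well_order lt &
    forall x, ~ (continuum_card #<= [set y | lt y x]).
Proof.
move=> jinj.
suff [lt lto short] : exists2 lt : (nat -> bool) -> (nat -> bool) -> Prop,
    strict_well_order lt & forall x, ~ (continuum_card #<= [set y | lt y x]).
  exists (fun x y => lt (j x) (j y)); first exact: strict_well_order_pullback.
  move=> x /card_le_trans le; apply: (short (j x)); apply: le.
  by apply: (@inj_set_card_le _ _ _ _ j); [apply: in2W | move=> _ [y /= ? <-]].
have [lt lto] := strict_well_order_exists (nat -> bool).
have [wf tr tri] := lto.
have [short|/existsNP[x0]] :=
  pselect (forall x, ~ (continuum_card #<= [set y | lt y x])).
  by exists lt.
move=> /contrapT; elim/(well_founded_ind wf): x0 => x0 IH big.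
have [[x [lx bigx]]|nbig] :=
    pselect (exists x, lt x x0 /\ (continuum_card #<= [set y | lt y x])).
  exact: (IH x).
have [i iinj ilt] := card_leT_inj big.
exists (fun x y => lt (i x) (i y)); first exact: strict_well_order_pullback.
move=> x /card_le_trans le; apply: nbig; exists (i x); split; first exact: ilt.
apply: le.
by apply: (@inj_set_card_le _ _ _ _ i); [apply: in2W | move=> _ [y /= ? <-]].
Qed.

(** * Realizing systems of conditions in an ultrapower *)

Lemma ultra_class_repr (L : language) (A : structure L) (u : set_system nat)
    (uF : ProperFilter u) (f : nat -> A) :
  u [set n | ultra_repr (ultra_class uF f) n = f n].
Proof.
have /eqmodP : (ultra_repr (ultra_class uF f) : {classic nat -> A})
    = f %[mod {eq_quot ultra_equiv A uF}]%qT by rewrite [LHS]reprK.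
by rewrite /= /ultra_eq => /asboolP.
Qed.

Section Conditions.
Variables (A : Type) (C : eqType) (holds : C -> seq A -> Prop).

(** A kind of condition, with the list of the unknowns that it is imposed on. *)
Definition condition (I : eqType) : eqType := (C * seq I)%type.

Definition holds_all (I : eqType) (F : seq (condition I)) (x : I -> A) : Prop :=
  forall t, t \in F -> holds t.1 (map x t.2).

Definition indices (I : eqType) (F : seq (condition I)) : seq I :=
  flatten (map snd F).

Lemma mem_indices (I : eqType) (F : seq (condition I)) t i :
  t \in F -> i \in t.2 -> i \in indices F.
Proof. by move=> tF it; apply/flattenP; exists t.2 => //; exact: map_f. Qed.
End Conditions.

Section PositivePrimitive.
Variables (A : Type) (a0 : A) (C : countType) (holds : C -> seq A -> Prop).

(** A symbol (k, m, F) stands for the formula that asks for values of all the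
    variables of F which satisfy every condition of F and which agree with the
    k arguments at those places i for which the i-th entry of m is true, entries
    past the end of m counting as true. *)
Definition pp_symbol : countType := (nat * seq bool * seq (C * seq nat))%type.

Definition pp_language : language := {|
  fun_symbol := void; fun_arity := fun=> 0%N;
  rel_symbol := pp_symbol; rel_arity := fun s => s.1.1 |}.

Definition pp_structure : structure pp_language := {|
  carrier := A; carrier_inhabited := inhabits a0;
  fun_interp := fun f : fun_symbol pp_language => match f with end;
  rel_interp := fun (s : rel_symbol pp_language) xs => exists v : nat -> A,
    (forall i : 'I_(s.1.1), nth true s.1.2 i -> v i = xs i) /\ holds_all holds s.2 v |}.

Variables (u : set_system nat) (uF : ProperFilter u).
Let M := ultrapower pp_structure uF.
Variables (I : eqType) (T : set (condition C I)).

(** The inductive hypothesis of the construction: for almost all n, the values of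
    b over D extend to a solution of any given finite part of T. *)
Definition compatible (D : set I) (b : I -> M) : Prop :=
  forall F, (forall t, t \in F -> T t) ->
  u [set n | exists2 x, holds_all holds F x &
     forall i, i \in indices F -> D i -> x i = ultra_repr (b i) n].

Section Step.
Variables (D : set I) (b : I -> M) (j : I) (Dj : ~ D j).

Let P : set M := b @` D.

Lemma par_subproof i : D i -> b i \in P.
Proof. by move=> Di; apply/mem_set; exists i. Qed.

Definition pp_term (i : I) : term pp_language P :=
  match pselect (D i) with
  | left Di => Par (exist _ (b i) (par_subproof Di))
  | right _ => Var 0%N
  end.

Definition pp_formula_symbol (F : seq (condition C I)) : rel_symbol pp_language :=
  (size (indices F), [seq `[< D i \/ i = j >] | i <- indices F],
   [seq (t.1, [seq index i (indices F) | i <- t.2]) | t <- F]).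

Definition pp_formula (F : seq (condition C I)) : formula pp_language P :=
  @Rel pp_language P (pp_formula_symbol F) (fun k => pp_term (nth j (indices F) k)).

(** For a formula consisting of one relation symbol, the fundamental theorem of
    ultraproducts is the definition of the ultrapower; the matter is to translate
    between unknowns and their positions in the list of indices. *)
Lemma satisfies_pp_formula (a : M) F :
  satisfies set_val (fun=> a) (pp_formula F) <->
  u [set n | exists2 x, holds_all holds F x & forall i, i \in indices F ->
     (D i -> x i = ultra_repr (b i) n) /\ (i = j -> x i = ultra_repr a n)].
Proof.
have evalE i : Defs.eval (L := pp_language) set_val (fun=> a) (pp_term i) =
    if pselect (D i) then b i else a.
  by rewrite /pp_term; case: pselect.
rewrite /=; set V := indices F.
suff E n : (exists v : nat -> A, (forall i : 'I_(size V),
    nth true [seq `[< D i \/ i = j >] | i <- V] i ->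
    v i = ultra_repr (Defs.eval (L := pp_language) (M := M) set_val (fun=> a)
       (pp_term (nth j V i))) n)
  /\ holds_all holds
    [seq (t.1, [seq index i V | i <- t.2]) | t <- F] v) <->
  (exists2 x, holds_all holds F x & forall i, i \in V ->
     (D i -> x i = ultra_repr (b i) n) /\ (i = j -> x i = ultra_repr a n)).
  by split; apply: filterS => n /= /E.
split=> [[v [vV vF]]|[x xF xV]].
- exists (fun i => v (index i V)).
    move=> t tF; have := vF (t.1, [seq index i V | i <- t.2]).
    rewrite /= -map_comp; apply.
    by apply/mapP; exists t.
  move=> i iV; have iV' : (index i V < size V)%N by rewrite index_mem.
  have := vV (Ordinal iV'); rewrite evalE /= (nth_map j) // nth_index //.
  move=> vi; split=> [Di|ij].
    by rewrite vi; [case: pselect|apply/asboolP; left].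
  by rewrite vi; [case: pselect => // Di; subst i|apply/asboolP; right].
- exists (fun k => x (nth j V k)); split.
    move=> i; rewrite evalE (nth_map j) // => /asboolP Dij.
    have [xD xj] := xV (nth j V i) (mem_nth j (ltn_ord i)).
    by case: pselect => Di; [rewrite xD|case: Dij => // e; rewrite xj].
  move=> _ /mapP [s sF ->] /=; rewrite -map_comp.
  have := xF s sF; congr (holds _ _); apply/eq_in_map => i si /=.
  by rewrite nth_index // (mem_indices sF).
Qed.

Lemma free_vars_pp_formula F : free_vars (pp_formula F) `<=` [set 0%N].
Proof. by move=> k [i] /=; rewrite /pp_term; case: pselect. Qed.

(** Finitely many of the formulas that a must satisfy follow from the one for the
    union of the finite parts of T that they come from, and compatibility
    provides solutions of the latter, whose values at j form the element
    sought. *)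
Lemma compatible_step : saturated M continuum_card -> card_lt D continuum_card ->
  compatible D b -> exists a : M, forall b' : I -> M,
    (forall i, D i -> b' i = b i) -> b' j = a ->
    compatible (D `|` [set j]) b'.
Proof.
move=> Msat [Dle Dlt] comp.
pose S := [set pp_formula F |
  F in [set F : seq (condition C I) | forall t, t \in F -> T t]].
have [||G finG GS|a aS] := Msat P S.
- split; first exact: card_le_trans (card_image_le _ _) Dle.
  by move=> /card_le_trans le; apply: Dlt; apply: le; exact: card_image_le.
- by move=> _ [F _ <-]; exact: free_vars_pp_formula.
- have /choice [code codeP] : forall phi : {classic (formula pp_language P)},
      exists F : seq (condition C I),
      S phi -> (forall t, t \in F -> T t) /\ phi = pp_formula F.
    move=> phi; have [[F FT <-]|nS] := pselect (S phi); last by exists [::].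
    by exists F.
  have [s sG] := (@finite_seqP {classic (formula pp_language P)} G).1 finG.
  pose F := flatten (map code s).
  have sS phi : phi \in s -> S phi by move=> phis; apply: GS; rewrite sG.
  have inF phi t : G phi -> t \in code phi -> t \in F.
    rewrite sG /= => phis ct; apply/flattenP; exists (code phi) => //.
    by apply/mapP; exists phi.
  have FT t : t \in F -> T t.
    by move=> /flattenP [_ /mapP [phi /sS /codeP [codeT _] ->]] /codeT.
  have /choice [x xP] : forall n, exists x : I -> A,
      (exists2 x, holds_all holds F x &
        forall i, i \in indices F -> D i -> x i = ultra_repr (b i) n) ->
      holds_all holds F x /\
      (forall i, i \in indices F -> D i -> x i = ultra_repr (b i) n).
    move=> n; have [[x xF xD]|no] := pselect (exists2 x, holds_all holds F x &
        forall i, i \in indices F -> D i -> x i = ultra_repr (b i) n).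
      by exists x.
    by exists (fun=> a0).
  exists (ultra_class uF (fun n => x n j : pp_structure)) => phi Gphi.
  have [codeT phiE] := codeP _ (GS _ Gphi).
  rewrite [in X in satisfies _ _ X]phiE; apply/satisfies_pp_formula.
  have := ultra_class_repr uF (fun n => x n j : pp_structure).
  apply: filterS2 (comp F FT) => n /xP [xF xD] cE.
  exists (x n); first by move=> t /(inF _ _ Gphi) /xF.
  move=> i ic; split; last by move=> ->.
  apply: xD; move: ic => /flattenP [_ /mapP [t tc ->]].
  by apply: mem_indices; exact: inF tc.
- exists a => b' b'D b'j F FT.
  have /satisfies_pp_formula : satisfies set_val (fun=> a) (pp_formula F).
    by apply: aS; exists F.
  apply: filterS => n [x xF xV]; exists x => // i iF.
  have [xD xj] := xV i iF.
  by move=> [Di|/= ij]; [rewrite b'D // xD|rewrite ij b'j -ij xj].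
Qed.
End Step.
End PositivePrimitive.

(** Since Q i b depends on b only below i, the values of b can be chosen by
    recursion along lt. *)
Lemma transfinite_choice (I M : Type) (lt : I -> I -> Prop)
    (Q : I -> (I -> M) -> M -> Prop) :
  well_founded lt -> inhabited M -> (forall i b, exists a, Q i b a) ->
  (forall i b b' a, (forall k, lt k i -> b k = b' k) -> Q i b a -> Q i b' a) ->
  exists b, forall i, Q i b (b i).
Proof.
move=> wf [m0] Qex Qext.
have /choice [f fP] : forall ib : I * (I -> M), exists a, Q ib.1 ib.2 a.
  by move=> ib; exact: Qex.
pose ext i (r : forall k, lt k i -> M) k :=
  if pselect (lt k i) is left ki then r k ki else m0.
pose step i (r : forall k, lt k i -> M) := f (i, ext i r).
pose b := Fix wf (fun=> M) step.
have bE i : b i = step i (fun k _ => b k).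
  rewrite /b Fix_eq // => {}i r r' rr'; congr (f (i, _)); apply/funext => k.
  by rewrite /ext; case: pselect.
exists b => i; rewrite bE; apply: Qext (fP (i, _)) => k ki /=.
by rewrite /ext; case: pselect.
Qed.

Lemma seq_max (I : eqType) (lt : I -> I -> Prop) (s : seq I) :
  strict_well_order lt ->
  s = [::] \/ exists2 m, m \in s & forall k, k \in s -> lt k m \/ k = m.
Proof.
move=> [_ tr tri]; elim: s => [|j s IH]; first by left.
right; case: IH => [->|[m ms mmax]].
  by exists j; rewrite ?mem_head // => k; rewrite inE => /eqP ->; right.
case: (tri m j) => [mj|mj|jm].
- exists j; rewrite ?mem_head // => k; rewrite inE => /predU1P [->|ks]; first by right.
  by left; case: (mmax k ks) => [km|->] //; exact: tr mj.
- by exists j; rewrite ?mem_head // => k; rewrite inE -mj => /predU1P [->|/mmax];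
    [right|].
- exists m; first by rewrite inE ms orbT.
  by move=> k; rewrite inE => /predU1P [->|/mmax]; [left|].
Qed.

(** Short well-orders make c-saturation, which speaks of a single variable,
    realize systems in continuum many variables: at each stage fewer than
    continuum many values have been fixed.  The values still to come are
    quantified away by the positive primitive formulas, so that no stage can
    block a later one.  A finite part of T involves finitely many indices, of
    which the largest one below i decides compatibility below i; hence nothing
    happens at limit stages. *)
Lemma realize_conditions (u : set_system nat) (A : Type) (C : countType)
    (holds : C -> seq A -> Prop) (I : eqType) (code : I -> nat -> bool)
    (T : set (condition C I)) :
  continuum_saturated_ultrafilter u -> inhabited A -> countable [set: A] ->
  injective code ->
  (forall F, (forall t, t \in F -> T t) -> exists x, holds_all holds F x) ->
  exists b : I -> nat -> A, forall t, T t ->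
    u [set n | holds t.1 [seq b i n | i <- t.2]].
Proof.
move=> [uU usat] [a0] Acount codei Tsat.
pose M := ultrapower (pp_structure a0 holds) (@ultra_proper _ _ uU).
have Msat : saturated M continuum_card.
  by apply: usat => //; split; exact: countableP.
have [lt lto short] := short_well_order codei; have [wf tr tri] := lto.
pose default : M := ultra_class (ultra_proper (F := u))
  (fun=> a0 : pp_structure a0 holds).
pose D i := [set k | lt k i].
have Dlt i : card_lt (D i) continuum_card.
  split; last exact: short.
  by apply: (@inj_set_card_le _ _ _ _ code) => //; apply: in2W.
pose Q i (b : I -> M) a := compatible T (D i) b -> forall b' : I -> M,
   (forall k, D i k -> b' k = b k) -> b' i = a ->
   compatible T (D i `|` [set i]) b'.
have compext E (b b' : I -> M) : (forall k, E k -> b k = b' k) ->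
    compatible T E b -> compatible T E b'.
  move=> bb' comp F FT; apply: filterS (comp F FT) => n [x xF xD].
  by exists x => // i iF Ei; rewrite xD // bb'.
have [|||b bQ] := @transfinite_choice I M lt Q wf.
- by split; exact: default.
- move=> i b; have [comp|ncomp] := pselect (compatible T (D i) b).
    have [|a aP] := compatible_step _ Msat (Dlt i) comp (j := i).
      by move=> ii; elim: (wf i) ii => k _ IH kk; exact: (IH _ kk kk).
    by exists a => _ b'; exact: aP.
  by exists default.
- move=> i b b' a bb' Qb comp b'' b''b' b''i.
  apply: Qb => // [|k Dk]; last by rewrite b''b' // bb'.
  by apply: compext comp => k /bb'.
have comp E : (forall i, E i -> compatible T (D i `|` [set i]) b) ->
    compatible T E b.
  move=> cE F FT.
  case: (@seq_max _ _ [seq k <- indices F | `[< E k >]] lto) => [noE|[m]].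
    have [x xF] := Tsat F FT; apply: filterE => n; exists x => // k kF Ek.
    suff : k \in [::] by [].
    by rewrite -noE mem_filter kF asboolT.
  rewrite mem_filter => /andP [/asboolP Em _] mmax.
  apply: filterS (cE m Em F FT) => n [x xF xm]; exists x => // k kF Ek.
  by apply: xm => //; apply: mmax; rewrite mem_filter kF asboolT.
have comp1 i : compatible T (D i `|` [set i]) b.
  by elim: (wf i) => k _ IH; apply: bQ => //; exact: comp.
exists (fun i n => ultra_repr (b i) n) => t Tt.
have FT s : s \in [:: t] -> T s by rewrite inE => /eqP ->.
have := comp setT (fun i _ => comp1 i) _ FT.
apply: filterS => n [x xF xE] /=.
have := xF t (mem_head _ _); congr (holds _ _); apply/eq_in_map => i it.
by apply: xE; rewrite // (mem_indices (mem_head t [::])).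
Qed.

(** By saturation the ultrapower of the natural numbers has an element above all
    of them, which is impossible when u contains a singleton. *)
Lemma saturated_ultrafilter_nonprincipal (u : set_system nat) (N : nat) :
  continuum_saturated_ultrafilter u -> u [set n | (N <= n)%N].
Proof.
move=> hu; have [uU _] := hu.
have [] := @realize_conditions u nat nat (fun m s => m < head 0 s)%N unit
  (fun _ _ => true) (fun t => t.2 = [:: tt]) hu (inhabits 0%N).
- exact: countableP.
- by move=> [] [].
- move=> F FT; exists (fun=> (sumn (map fst F)).+1) => t tF.
  rewrite (FT t tF) /= ltnS; elim: F tF {FT} => //= s F IH.
  rewrite inE => /predU1P [->|/IH le]; first exact: leq_addr.
  exact: leq_trans le (leq_addl _ _).
move=> b bP.
have nsing m : u [set n | n != m].
  have [//|neg] := in_ultra_setVsetC [set n | n != m] uU.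
  have /= := filter_ex (filterI neg (bP (b tt m, [:: tt]) erefl)).
  by move=> [n [/= /negP]]; rewrite negbK => /eqP ->; rewrite ltnn.
elim: N => [|N IH]; first exact: filterE.
by apply: filterS2 IH (nsing N) => n /= Nn nN; rewrite ltn_neqAle eq_sym nN.
Qed.

Local Open Scope ring_scope.

(** * The standard subcontinuum *)

Section Subtypes.
Variables (X : topologicalType) (A : set X).

Lemma set_type_cvg (F : set_system A) (p : A) : Filter F ->
  set_val @ F --> set_val p -> F --> p.
Proof.
move=> FF cF B [_ [[O oO <-] Op OB]]; apply: filterS OB _.
by apply: cF; exact: open_nbhs_nbhs.
Qed.

Lemma set_val_continuous : continuous (set_val : A -> X).
Proof. exact: initial_continuous. Qed.

Lemma set_type_compact : compact A -> compact [set: A].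
Proof.
move=> cA F PF _.
have [|p [Ap pcl]] := cA (set_val @ F) _.
  by apply: (@filterE _ F) => q; rewrite /preimage /=; exact: set_valP.
exists (exist _ p (mem_set Ap)); split=> // B C FB [_ [[O oO <-] Op OC]].
have [||_ [[q Bq <-] Oq]] := pcl (set_val @` B) O.
- by apply: (@filterS _ F _ B) => // q Bq; exists q.
- exact: open_nbhs_nbhs.
- by exists q; split=> //; exact: OC.
Qed.

Lemma set_type_hausdorff : hausdorff_space X -> hausdorff_space A.
Proof.
move=> hX p q pq; apply: val_inj; apply: hX => B C pB qC.
have [r [Br Cr]] := pq _ _ (set_val_continuous pB) (set_val_continuous qC).
by exists (set_val r).
Qed.
End Subtypes.

Section StoneCechTheory.
Variables (R : realType) (X : topologicalType).
Local Notation I := (unit_interval R).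
Local Notation C := (continuousType X I).

Lemma unit_interval_compact : compact [set: I].
Proof. by apply: set_type_compact; exact: segment_compact. Qed.

Lemma unit_interval_hausdorff : hausdorff_space I.
Proof. by apply: set_type_hausdorff; exact: Rhausdorff. Qed.

Lemma cube_compact : compact [set: cube R X].
Proof.
have := tychonoff (fun _ : C => unit_interval_compact).
by congr compact; apply/seteqP; split.
Qed.

Lemma cube_hausdorff : hausdorff_space (cube R X).
Proof. exact: (hausdorff_product (fun _ : C => unit_interval_hausdorff)). Qed.

Lemma stone_cech_compact : compact [set: stone_cech R X].
Proof.
apply: set_type_compact; apply: subclosed_compact cube_compact _ => //.
exact: closed_closure.
Qed.

Lemma stone_cech_hausdorff : hausdorff_space (stone_cech R X).
Proof. by apply: set_type_hausdorff; exact: cube_hausdorff. Qed.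

(** The compactification lies in a cube with one coordinate for each f, and that
    coordinate is the extension of f. *)
Definition extension (f : C) (p : stone_cech R X) : R := set_val (set_val p f).

Lemma extension_unit f x : extension f (stone_cech_unit R x) = set_val (f x).
Proof. by []. Qed.

Lemma extension_continuous f : continuous (extension f).
Proof.
move=> p; apply: continuous_comp; last exact: set_val_continuous.
apply: (@continuous_comp _ (cube R X) _ (set_val : stone_cech R X -> cube R X)
  (fun q => q f) p).
  exact: (@set_val_continuous (cube R X)).
exact: (@proj_continuous C (fun=> I) f).
Qed.

(** The compactification has the topology of pointwise convergence. *)
Lemma cvg_extension (F : set_system (stone_cech R X)) p : Filter F ->
  (forall f, extension f @ F --> extension f p) -> F --> p.
Proof.
move=> FF cF; apply: set_type_cvg; apply/cvg_sup => f B.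
move=> [_ [[O oO <-] Op OB]]; apply: filterS OB _.
have : set_val @ ((fun q : stone_cech R X => set_val q f) @ F) -->
    set_val (set_val p f).
  exact: cF.
by move/set_type_cvg; apply; exact: open_nbhs_nbhs.
Qed.

Lemma stone_cech_unit_continuous : continuous (@stone_cech_unit R X).
Proof.
move=> x; apply: cvg_extension => f.
apply: (@continuous_comp _ _ _ f (set_val : I -> R) x); first exact: cts_fun.
exact: set_val_continuous.
Qed.
End StoneCechTheory.

Section UnitInterval.
Variable R : realType.
Local Notation I := (unit_interval R).

Definition clamp (x : R) : R := Num.max 0 (Num.min x 1).

Lemma clampP x :
  [\/ x < 0 /\ clamp x = 0, 0 <= x <= 1 /\ clamp x = x | 1 < x /\ clamp x = 1].
Proof.
rewrite /clamp; case: (leP x 1) => x1; last first.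
  by apply: Or33; split=> //; case: (leP (0 : R) 1) => // /ltW; lra.
by case: (leP 0 x) => x0; [apply: Or32|apply: Or31]; rewrite ?x0 ?x1.
Qed.

Lemma clamp_itv x : 0 <= clamp x <= 1.
Proof. by case: (clampP x) => -[? ->]; lra. Qed.

Lemma clamp_id x : 0 <= x <= 1 -> clamp x = x.
Proof. by case: (clampP x) => -[? ->]; lra. Qed.

Lemma clamp_lipschitz x y : `|clamp x - clamp y| <= `|x - y|.
Proof.
rewrite !ler_norml; have := ler_norm (x - y); have := ler_norm (- (x - y)).
by rewrite normrN; case: (clampP x) => -[? ->]; case: (clampP y) => -[? ->]; lra.
Qed.

Lemma clamp_continuous : continuous clamp.
Proof.
move=> x; apply/cvgrPdist_lt => e e0.
have /cvgrPdist_lt /(_ _ e0) : (y @[y --> x]) --> x by exact: cvg_id.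
by apply: filterS => y; exact: le_lt_trans (clamp_lipschitz _ _).
Qed.

Lemma mem_unit (x : R) : 0 <= x <= 1 -> x \in (`[0, 1]%classic : set R).
Proof. by move=> x01; apply/mem_set; rewrite /= in_itv. Qed.

Definition to_unit (x : R) : I := exist _ (clamp x) (mem_unit (clamp_itv x)).

Lemma unit_itv (t : I) : 0 <= (set_val t : R) <= 1.
Proof. by have := set_valP t; rewrite /= in_itv. Qed.

Lemma to_unitK : cancel (set_val : I -> R) to_unit.
Proof. by move=> t; apply: val_inj => /=; rewrite clamp_id // unit_itv. Qed.

Lemma to_unit_continuous : continuous to_unit.
Proof. by apply: continuous_comp_initial; exact: clamp_continuous. Qed.

Lemma unit_interval_connected : connected [set: I].
Proof.
have -> : [set: I] = to_unit @` `[0, 1]%classic.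
  apply/seteqP; split=> // t _; exists (set_val t); first exact: set_valP.
  exact: to_unitK.
apply: connected_continuous_connected; first exact: segment_connected.
by apply: continuous_subspaceT; exact: to_unit_continuous.
Qed.
End UnitInterval.

Section StandardSubcontinuumTheory.
Variables (R : realType) (u : set_system nat) (uU : UltraFilter u).
Local Notation I := (unit_interval R).
Local Notation iota := (@stone_cech_unit R (MM R)).

Lemma cluster_II (G : set_system (stone_cech R (MM R))) : ProperFilter G ->
  (forall U, u U -> G (iota @` (U `*` setT))) ->
  exists p : II R u, cluster G (set_val p).
Proof.
move=> PG GU; have [|p [_ pG]] := stone_cech_compact PG; first exact: filterT.
have pII : II_set u p by move=> U /GU GUU B pB; exact: pG.
by exists (exist _ p (mem_set pII)).
Qed.

Lemma II_closure (p : II R u) U : u U -> closure (iota @` (U `*` setT)) (set_val p).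
Proof. by move=> uU'; exact: (set_valP p). Qed.

Lemma II_set_closed : closed (II_set u : set (stone_cech R (MM R))).
Proof. by apply: closed_bigI => U _; exact: closed_closure. Qed.

Lemma II_compact : compact [set: II R u].
Proof.
apply: set_type_compact; apply: subclosed_compact (@stone_cech_compact _ _) _ => //.
exact: II_set_closed.
Qed.

Lemma II_hausdorff : hausdorff_space (II R u).
Proof. by apply: set_type_hausdorff; exact: stone_cech_hausdorff. Qed.

Lemma II_nonempty : [set: II R u] !=set0.
Proof.
pose f n := iota (n, to_unit 0 : I).
have [U uU'|p _] := @cluster_II (f @ u) _; last by exists p.
by apply: (@filterS _ u _ U) => // n Un; exists (n, to_unit 0).
Qed.

Lemma fiber_continuous n : continuous (fun t : I => (n, t) : MM R).
Proof.
move=> t A [[B D] [/= nB tD] BD]; apply: filterS tD => s Ds.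
by apply: BD; split=> //; exact: nbhs_singleton nB.
Qed.

Lemma fiber_connected n : connected [set iota (n, t) | t in [set: I]].
Proof.
apply: connected_continuous_connected; first exact: unit_interval_connected.
apply: continuous_subspaceT => t.
apply: (@continuous_comp _ _ _ (fun t : I => (n, t) : MM R) iota).
  exact: fiber_continuous.
exact: stone_cech_unit_continuous.
Qed.

(** Separate two closed parts by open sets V and W of the compactification.  By
    compactness all intervals with numbers in some member U of u are covered by V
    and W, and each of them, being connected, lies in V or in W.  As u is an
    ultrafilter, almost all of them lie on the same side, and the other part is
    empty. *)
Lemma II_connected : connected [set: II R u].
Proof.
move=> B [b Bb] [O oO BO] [K cK BK].
move: BO BK; rewrite !setTI => BO BK; apply/seteqP; split=> // q _.
apply: contrapT => nBq.
have img_closed (A : set (II R u)) : closed A -> closed (set_val @` A).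
  move=> cA; apply: compact_closed; first exact: stone_cech_hausdorff.
  apply: continuous_compact.
    by apply: continuous_subspaceT; exact: set_val_continuous.
  by apply: subclosed_compact II_compact _.
have [||//|V [W [oV oW BV BW VW]]] := (@normal_openP R (stone_cech R (MM R))).1
   (compact_normal (@stone_cech_hausdorff _ _) (@stone_cech_compact _ _))
   (set_val @` B) (set_val @` (~` B)).
- by apply: img_closed; rewrite BK.
- by apply: img_closed; apply: open_closedC; rewrite BO.
- by apply/seteqP; split=> // _ [[x Bx <-] [y nBy /val_inj yx]]; rewrite yx in nBy.
have [U uU' UVW] : exists2 U, u U & iota @` (U `*` setT) `<=` V `|` W.
  apply: contrapT => noU.
  pose G := filter_from u (fun U => iota @` (U `*` setT) `\` (V `|` W)).
  have PG : ProperFilter G.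
    apply: filter_from_proper; last first.
      move=> U uU'; apply: contrapT => /nonemptyPn U0; apply: noU; exists U => //.
      by rewrite -setD_eq0.
    apply: filter_from_filter; first by exists setT; exact: filterT.
    move=> U U' uU' uU''; exists (U `&` U'); first exact: filterI.
    by move=> _ [[x [[Ux U'x] _] <-] nVW]; split; (split; [exists x|]).
  have [U uU'|p pG] := cluster_II PG; first by exists U => // x [].
  have [||x [[_ nx] xVW]] := pG (setT `\` (V `|` W)) (V `|` W).
  - by exists setT; [exact: filterT|move=> x []].
  - apply: open_nbhs_nbhs; split; first exact: openU.
    have [Bp|nBp] := pselect (B p); first by left; apply: BV; exists p.
    by right; apply: BW; exists p.
  - exact: nx.
have sep : separated V W.
  have cl (S S' : set (stone_cech R (MM R))) :
      open S' -> S `&` S' = set0 -> closure S `&` S' = set0.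
    move=> oS' SS'; apply/seteqP; split=> // x [/(_ S') + S'x].
    rewrite SS' => /(_ _) [|y []]; exact: open_nbhs_nbhs.
  by split; [exact: cl|rewrite setIC; apply: cl; rewrite // setIC].
pose U0 := [set n | [set iota (n, t) | t in [set: I]] `<=` V].
have nVW x : V x -> W x -> False.
  by move=> Vx Wx; have : (V `&` W) x by []; rewrite VW.
have [uU0|uU0] := in_ultra_setVsetC U0 uU.
- have Wq : W (set_val q) by apply: BW; exists q.
  have [_ [[[n t] [U0n _] <-] Wx]] := II_closure uU0 (open_nbhs_nbhs (conj oW Wq)).
  by apply: nVW Wx; apply: U0n; exists t.
- have Vb : V (set_val b) by apply: BV; exists b.
  have [_ [[[n t] [[U0n Un] _] <-] Vx]] :=
    II_closure (filterI uU0 uU') (open_nbhs_nbhs (conj oV Vb)).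
  have [|//|nW] := connected_subset sep _ (@fiber_connected n).
    by move=> _ [s _ <-]; apply: UVW; exists (n, s).
  by apply: nVW Vx _; apply: nW; exists t.
Qed.

Lemma II_continuum : continuum (II R u).
Proof.
split; [exact: II_nonempty|exact: II_compact|exact: II_connected|].
exact: II_hausdorff.
Qed.
End StandardSubcontinuumTheory.

(** * The weight of the standard subcontinuum *)

Section ContinuumCodes.

Definition at_most_continuum (T : Type) : Prop :=
  exists code : T -> nat -> bool, injective code.

Lemma count_at_most_continuum (T : countType) : at_most_continuum T.
Proof.
exists (fun x n => n == pickle x) => x y /(congr1 (fun g => g (pickle x))).
by rewrite eqxx => /esym/eqP /(pcan_inj pickleK).
Qed.

Lemma pair_at_most_continuum T U :
  at_most_continuum T -> at_most_continuum U -> at_most_continuum (T * U).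
Proof.
move=> [c ci] [d di].
pose e (x : T * U) n := match unpickle n with
  | Some (true, k) => c x.1 k | Some (false, k) => d x.2 k | None => false end.
have eT x (k : nat) : e x (pickle (true, k)) = c x.1 k by rewrite /e pickleK.
have eF x (k : nat) : e x (pickle (false, k)) = d x.2 k by rewrite /e pickleK.
exists e => -[x1 x2] [y1 y2] exy; congr pair.
- by apply: ci; apply/funext => k; rewrite -(eT (x1, x2)) exy eT.
- by apply: di; apply/funext => k; rewrite -(eF (x1, x2)) exy eF.
Qed.

Lemma seq_at_most_continuum T : at_most_continuum T -> at_most_continuum (seq T).
Proof.
move=> [c ci].
pose e (s : seq T) n := match unpickle n with
  | Some (i, b, k) => if onth s i is Some x then b || c x k else false
  | None => false end.
have eE s (i : nat) (b : bool) (k : nat) : e s (pickle (i, b, k)) =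
  if onth s i is Some x then b || c x k else false by rewrite /e pickleK.
have onth_inj (s s' : seq T) : (forall i, onth s i = onth s' i) -> s = s'.
  elim: s s' => [|x s IH] [|y s'] //= H; try by have := H 0%N.
  have [->] := H 0%N; congr cons; apply: IH => i; exact: (H i.+1).
exists e => s s' ess; apply: onth_inj => i.
have eq (b : bool) (k : nat) := congr1 (fun g => g (pickle (i, b, k))) ess.
move: eq; case si: (onth s i) => [x|]; case s'i: (onth s' i) => [y|] // eq.
- congr Some; apply: ci; apply/funext => k.
  by have := eq false k; rewrite !eE si s'i.
- by have := eq true 0%N; rewrite !eE si s'i.
- by have := eq true 0%N; rewrite !eE si s'i.
Qed.

Lemma at_most_continuum_card_le T U (f : T -> U) : at_most_continuum T ->
  range f #<= continuum_card.
Proof.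
move=> [c ci]; apply: card_le_trans (card_image_le _ _) _.
by apply: (@inj_set_card_le _ _ _ _ c) => //; apply: in2W.
Qed.
End ContinuumCodes.

Lemma filter_all_seq (T : Type) (I : eqType) (F : set_system T) (P : I -> set T)
    (s : seq I) : Filter F -> (forall i, i \in s -> F (P i)) ->
  F [set x | forall i, i \in s -> P i x].
Proof.
move=> FF; elim: s => [|i s IH] FP; first exact: filterE.
have Fs : F [set x | forall i, i \in s -> P i x].
  by apply: IH => k ks; apply: FP; rewrite inE ks orbT.
apply: filterS2 (FP i (mem_head _ _)) Fs => x Pi Ps k.
by rewrite inE => /predU1P [->|/Ps].
Qed.

Section Weight.
Variables (R : realType).
Local Notation I := (unit_interval R).
Local Notation C := (continuousType (MM R) I).
Local Notation iota := (@stone_cech_unit R (MM R)).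

Lemma MM_continuous (Z : topologicalType) (h : MM R -> Z) :
  (forall n, continuous (fun t => h (n, t))) -> continuous h.
Proof.
move=> hc [n t] B hB; exists ([set n], [set s | B (h (n, s))]) => /=.
  by split; [exact/principal_filterP|exact: hc].
by move=> [m s] [/= ->].
Qed.

Section Sheets.
Variables (g : nat -> R -> R) (gc : forall n, continuous (g n)).

Lemma sheets_continuous :
  continuous (fun x : MM R => to_unit (g x.1 (set_val x.2))).
Proof.
apply: MM_continuous => n t /=; apply: continuous_comp; last first.
  exact: to_unit_continuous.
by apply: continuous_comp; [exact: set_val_continuous|exact: gc].
Qed.

(** The function on the countable sum of intervals that is g n on the n-th one,
    cut off at 0 and 1. *)
Definition sheets : C := mkcts sheets_continuous.

Lemma sheetsE n t : set_val (sheets (n, t)) = clamp (g n (set_val t)).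
Proof. by []. Qed.
End Sheets.

Section Cells.

(** The number that the first n digits of alpha denote in the binary system. *)
Fixpoint address (alpha : nat -> bool) (n : nat) : nat :=
  if n is n'.+1 then (alpha n' + (address alpha n').*2)%N else 0%N.

Lemma address_lt alpha n : (address alpha n < 2 ^ n)%N.
Proof.
elim: n => //= n IH; rewrite expnS mul2n.
by case: (alpha n); rewrite ?add0n ?add1n ?ltn_double ?ltn_Sdouble.
Qed.

Lemma address_inj alpha beta n :
  address alpha n = address beta n -> forall i, (i < n)%N -> alpha i = beta i.
Proof.
elim: n => //= n IH e; have en : alpha n = beta n.
  by have := congr1 odd e; rewrite !oddD !odd_double !addbF !oddb.
move: e; rewrite en => /addnI /double_inj e i.
by rewrite ltnS leq_eqVlt => /predU1P [->|/(IH e)].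
Qed.

(** On the n-th interval, a tent over the dyadic point whose address consists of
    the first n digits of alpha. *)
Definition tent (alpha : nat -> bool) (n : nat) (x : R) : R :=
  1 - 2 * `|2 ^+ n * x - (address alpha n)%:R|.

Lemma tent_continuous alpha n : continuous (tent alpha n).
Proof.
move=> x; apply: cvgB; first exact: cvg_cst.
apply: cvgM; first exact: cvg_cst.
apply: cvg_norm; apply: cvgB; last exact: cvg_cst.
by apply: cvgM; [exact: cvg_cst|exact: cvg_id].
Qed.

Lemma tent_disjoint alpha beta n x :
  1/2 < tent alpha n x -> 1/2 < tent beta n x -> address alpha n = address beta n.
Proof.
rewrite /tent => ha hb; apply/eqP; rewrite -(eqr_nat R) -subr_eq0.
have {}ha : `|2 ^+ n * x - (address alpha n)%:R| < 1/4 by lra.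
have {}hb : `|2 ^+ n * x - (address beta n)%:R| < 1/4 by lra.
move: ha hb; move: (2 ^+ n * x) => y; rewrite !ltr_norml => ha hb.
have [lt|lt|->] := ltngtP (address alpha n) (address beta n); last by rewrite subrr.
- have : ((address alpha n).+1%:R <= (address beta n)%:R :> R) by rewrite ler_nat.
  by rewrite -natr1; lra.
- have : ((address beta n).+1%:R <= (address alpha n)%:R :> R) by rewrite ler_nat.
  by rewrite -natr1; lra.
Qed.
End Cells.

Variables (u : set_system nat) (uU : UltraFilter u).

Definition cell_function alpha : C := sheets (@tent_continuous alpha).

Definition cell alpha : set (II R u) :=
  [set p | 1/2 < extension (cell_function alpha) (set_val p)].

Lemma extension_II_continuous (f : C) :
  continuous (fun p : II R u => extension f (set_val p)).
Proof.
move=> p; apply: (@continuous_comp _ _ _ set_val (extension f)).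
  exact: set_val_continuous.
exact: extension_continuous.
Qed.

Lemma open_extension_gt (f : C) (a : R) : open [set q | a < extension f q].
Proof.
have /continuousP H := @extension_continuous R (MM R) f.
by have := H _ (@open_gt _ a).
Qed.

Lemma cell_open alpha : open (cell alpha).
Proof.
have /continuousP H := @extension_II_continuous (cell_function alpha).
by have := H _ (@open_gt _ (1 / 2)).
Qed.

Lemma cell_nonempty alpha : cell alpha !=set0.
Proof.
pose pt n : I := to_unit ((address alpha n)%:R / 2 ^+ n).
have ptE n : set_val (pt n) = (address alpha n)%:R / 2 ^+ n.
  have -> : set_val (pt n) = clamp ((address alpha n)%:R / 2 ^+ n) by [].
  rewrite clamp_id // divr_ge0 ?exprn_ge0 //= ler_pdivrMr ?exprn_gt0 // mul1r.
  by rewrite -natrX ler_nat ltnW // address_lt.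
have one n : extension (cell_function alpha) (iota (n, pt n)) = 1.
  rewrite extension_unit sheetsE ptE /tent mulrCA divff ?expf_neq0 ?pnatr_eq0 // mulr1.
  by rewrite subrr normr0 mulr0 subr0 clamp_id // ler01 lexx.
have [U uU'|p pG] := @cluster_II R u ((fun n => iota (n, pt n)) @ u) _.
  by apply: (@filterS _ u _ U) => // n Un; exists (n, pt n).
exists p; rewrite /cell /= ltNge; apply/negP => le.
pose B := extension (cell_function alpha) @^-1` [set x | x < 1].
have [||q [/= q1 q2]] := pG [set q | extension (cell_function alpha) q = 1] B.
- by apply: (@filterE _ u) => n; exact: one.
- apply: open_nbhs_nbhs; split; last by rewrite /B /=; lra.
  have /continuousP H := @extension_continuous R (MM R) (cell_function alpha).
  by have := H _ (@open_lt _ 1).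
- by move: q2; rewrite /B /= q1 ltxx.
Qed.

(** If alpha and beta differ at k, then on all the intervals with numbers above k
    their tents exceed 1/2 on disjoint sets, and almost all numbers are above
    k. *)
Lemma cell_disjoint (unp : forall N, u [set n | (N <= n)%N]) alpha beta :
  cell alpha `&` cell beta !=set0 -> alpha = beta.
Proof.
move=> [p [/= pa pb]]; apply/funext => k.
have [] := II_closure (p := p) (unp k.+1)
  (B := [set q | 1/2 < extension (cell_function alpha) q] `&`
        [set q | 1/2 < extension (cell_function beta) q]).
  by apply: open_nbhs_nbhs; split=> //; apply: openI; exact: open_extension_gt.
move=> _ [[[n t] [/= kn _] <-] [/=]]; rewrite !extension_unit !sheetsE => ha hb.
apply: (@address_inj alpha beta n) => //.
apply: (@tent_disjoint _ _ _ (set_val t)).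
- by move: ha; case: (clampP (tent alpha n (set_val t))) => -[? ->]; lra.
- by move: hb; case: (clampP (tent beta n (set_val t))) => -[? ->]; lra.
Qed.

Lemma II_weight_ge (unp : forall N, u [set n | (N <= n)%N])
  (B : set (set (II R u))) : basis B -> continuum_card #<= B.
Proof.
move=> [_ Bcvg].
have /choice [f fP] : forall alpha, exists V, [/\ B V, V !=set0 & V `<=` cell alpha].
  move=> alpha; have [p pa] := cell_nonempty alpha.
  have [V [BV Vp] Va] := Bcvg p _ (open_nbhs_nbhs (conj (cell_open alpha) pa)).
  by exists V; split=> //; exists p.
apply: (@inj_set_card_le _ _ _ _ f); last by move=> _ [a _ <-]; case: (fP a).
apply: in2W => a b fab; apply: (cell_disjoint unp).
have [_ [p ap] fa] := fP a; have [_ _ fb] := fP b.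
by exists p; split; [exact: fa|apply: fb; rewrite -fab].
Qed.
End Weight.

Section WeightUpper.
Variables (R : realType).
Local Notation I := (unit_interval R).
Local Notation C := (continuousType (MM R) I).

(** By continuity f is determined by the truth values of the inequalities
    f (n, q) < r for rational q and r. *)
Lemma continuous_functions_at_most_continuum : at_most_continuum C.
Proof.
pose c (f : C) (k : nat) := match unpickle k with
  | Some (n, q, r) => set_val (f (n, to_unit (ratr q))) < ratr r
  | None => false end.
have cE f (n : nat) (q r : rat) :
    c f (pickle (n, q, r)) = (set_val (f (n, to_unit (ratr q))) < ratr r).
  by rewrite /c pickleK.
have lt_ne (f g : C) n t : set_val (f (n, t)) < set_val (g (n, t)) -> c f <> c g.
  move=> lt cfg; have [r] := rat_in_itvoo lt; rewrite in_itv /= => /andP[fr rg].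
  pose at_ (h : C) (x : R) : R := set_val (h (n, to_unit x)).
  have at_cont h : continuous (at_ h).
    have c2 : continuous (fun x : MM R => set_val (h x) : R).
      by move=> x; apply: continuous_comp; [exact: cts_fun|exact: set_val_continuous].
    move=> x; apply: (@continuous_comp _ _ _ _ (fun x : MM R => set_val (h x) : R)).
      apply: (@continuous_comp _ _ _ (@to_unit R)); first exact: to_unit_continuous.
      exact: fiber_continuous.
    exact: c2.
  have oS : open [set x | at_ f x < ratr r /\ ratr r < at_ g x].
    apply: openI.
      have /continuousP H := at_cont f; by have := H _ (@open_lt _ (ratr r)).
    have /continuousP H := at_cont g; by have := H _ (@open_gt _ (ratr r)).
  have [|x [[fr' rg'] [q _ qE]]] := @dense_rat R _ _ oS.
    by exists (set_val t); rewrite /at_ /= to_unitK.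
  have := congr1 (fun e => e (pickle (n, q, r))) cfg.
  rewrite /at_ -qE in fr' rg'; rewrite /= !cE fr' => /esym /(lt_trans rg').
  by rewrite ltxx.
exists c => f g cfg; apply/continuousEP => -[n t]; apply: val_inj.
have [lt|lt|//] := ltgtP (set_val (f (n, t))) (set_val (g (n, t))).
- by case: (lt_ne _ _ _ _ lt cfg).
- by case: (lt_ne _ _ _ _ lt (esym cfg)).
Qed.

Variables (u : set_system nat) (uU : UltraFilter u).

Definition basic_open (s : seq (C * rat * rat)) : set (II R u) :=
  [set p | forall c, c \in s ->
     ratr c.1.2 < extension c.1.1 (set_val p) /\
     extension c.1.1 (set_val p) < ratr c.2].

Lemma basic_open_open s : open (basic_open s).
Proof.
rewrite openE => p ps; rewrite /interior; apply: filter_all_seq => c cs.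
have [lo hi] := ps c cs; apply: filterI.
- apply: open_nbhs_nbhs; split=> //.
  have /continuousP H := @extension_II_continuous R u c.1.1.
  by have := H _ (@open_gt _ (ratr c.1.2)).
- apply: open_nbhs_nbhs; split=> //.
  have /continuousP H := @extension_II_continuous R u c.1.1.
  by have := H _ (@open_lt _ (ratr c.2)).
Qed.

Lemma basic_open_basis : basis (range basic_open).
Proof.
split=> [_ [s _ <-]|p]; first exact: basic_open_open.
have FF : Filter (filter_from [set U | (range basic_open) U /\ U p] id).
  apply: filter_from_filter.
    by exists (basic_open [::]); split=> //; exists [::].
  move=> _ _ [[s _ <-] ps] [[s' _ <-] ps']; exists (basic_open (s ++ s')).
    split; first by exists (s ++ s').
    by move=> c; rewrite mem_cat => /orP[/ps|/ps'].
  move=> q qss; split=> c cs; apply: qss; rewrite mem_cat cs ?orbT //.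
apply: set_type_cvg; apply: cvg_extension => f; apply/cvgrPdist_lt => e e0.
have [a] := @rat_in_itvoo R (extension f (set_val p) - e) (extension f (set_val p))
  ltac:(lra).
have [b] := @rat_in_itvoo R (extension f (set_val p)) (extension f (set_val p) + e)
  ltac:(lra).
rewrite !in_itv /= => /andP [b1 b2] /andP [a1 a2].
exists (basic_open [:: (f, a, b)]).
  split; first by exists [:: (f, a, b)].
  by move=> c; rewrite inE => /eqP ->.
move=> q /(_ (f, a, b) (mem_head _ _)) [/= qa qb].
by rewrite /= ltr_norml; lra.
Qed.

Lemma II_weight (unp : forall N, u [set n | (N <= n)%N]) :
  weight_eq (II R u) continuum_card.
Proof.
split; last by move=> B; exact: II_weight_ge.
exists (range basic_open); first exact: basic_open_basis.
rewrite card_eq_le; apply/andP; split; last first.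
  by apply: II_weight_ge => //; exact: basic_open_basis.
apply: at_most_continuum_card_le; apply: seq_at_most_continuum.
apply: pair_at_most_continuum (count_at_most_continuum _).
apply: pair_at_most_continuum (count_at_most_continuum _).
exact: continuous_functions_at_most_continuum.
Qed.
End WeightUpper.

(** * Polygonal paths *)

Section Polyline.
Variable R : realType.

(** The polygonal path whose vertices v are passed at the times 0, 1, 2 and so
    on, constant before and after. *)
Fixpoint polyline (v : seq R) (x : R) : R :=
  match v with
  | [::] => 0
  | a :: w => if w is b :: _ then (b - a) * (clamp x - 1) + polyline w (x - 1)
              else a
  end.

Lemma polyline_cons a b w x : polyline [:: a, b & w] x =
  (b - a) * (clamp x - 1) + polyline (b :: w) (x - 1).
Proof. by []. Qed.

Lemma polyline_continuous v : continuous (polyline v).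
Proof.
elim: v => [|a [|b w] IH] x; [exact: cvg_cst|exact: cvg_cst|].
apply: cvgD.
  apply: cvgM; first exact: cvg_cst.
  by apply: cvgB; [exact: clamp_continuous|exact: cvg_cst].
apply: (@continuous_comp _ _ _ (fun y : R => y - 1) (polyline (b :: w)));
  last exact: IH.
by apply: cvgB; [exact: cvg_id|exact: cvg_cst].
Qed.

Lemma polyline_start v x : x <= 0 -> polyline v x = head 0 v.
Proof.
elim: v x => [|a [|b w] IH] x x0 //.
rewrite polyline_cons IH /=; last by lra.
have -> : clamp x = 0 by case: (clampP x) => -[? ->]; lra.
by ring.
Qed.

Lemma polyline_vertex v k : (k < size v)%N -> polyline v k%:R = nth 0 v k.
Proof.
elim: v k => [|a [|b w] IH] [|k] // kv; first by rewrite polyline_start.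
rewrite polyline_cons -natr1 addrK IH //.
have -> : clamp (k%:R + 1 : R) = 1.
  by have := ler0n R k; case: (clampP (k%:R + 1 : R)) => -[? ->]; lra.
by rewrite subrr mulr0 add0r.
Qed.

(** The position on the path depends on the time alone, so that all coordinates
    of a path in a cube are interpolated in the same way. *)
Lemma polyline_segment N (x : R) : (0 < N)%N -> 0 <= x <= N%:R ->
  exists2 k, (k < N)%N & exists2 s : R, 0 <= s <= 1 & forall v, size v = N.+1 ->
    polyline v x = (1 - s) * nth 0 v k + s * nth 0 v k.+1.
Proof.
elim: N x => // N IH x _ /andP[x0 xN].
have [x1|x1] := leP x 1.
  exists 0%N => //; exists x; first by rewrite x0.
  move=> [|a [|b w]] // _; rewrite polyline_cons polyline_start /=; last by lra.
  by rewrite clamp_id ?x0 //; ring.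
have N0 : (0 < N)%N.
  by rewrite lt0n; apply/eqP => N0; move: xN; rewrite N0; lra.
have [|k kN [s s01 sP]] := IH (x - 1) N0.
  by move: xN; rewrite -natr1; lra.
exists k.+1 => //; exists s => // -[|a [|b w]] // [vN].
rewrite polyline_cons sP /= ?vN //.
have -> : clamp x = 1 by case: (clampP x) => -[? ->]; lra.
by ring.
Qed.

(** The polygon with vertices s is run through while t goes from 0 to 1. *)
Definition path_value (s : seq rat) (t : R) : R :=
  clamp (polyline (map ratr s) ((size s).-1%:R * t)).

End Polyline.

(** * Finitely many conditions on a continuum *)

Section Chains.
Variables (Y : topologicalType) (e : rel Y).
Hypotheses (conn : connected [set: Y]) (esym : symmetric e).
Hypothesis enbhs : forall y, nbhs y [set z | e y z].

(** The set of the points that a chain from y can reach is open and closed. *)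
Lemma chain_between y z : exists2 s, path e y s & last y s = z.
Proof.
pose B := [set z | exists2 s, path e y s & last y s = z].
suff : B = setT by move=> BT; have : B z by rewrite BT.
apply: conn; first by exists y, [::].
- exists B; last by rewrite setTI.
  rewrite openE => w [s ps <-]; rewrite /interior; apply: filterS (enbhs _) => v ev.
  by exists (rcons s v); rewrite ?last_rcons // rcons_path ps.
- exists B; last by rewrite setTI.
  rewrite -[B]setCK; apply: open_closedC; rewrite openE => w nBw.
  rewrite /interior; apply: filterS (enbhs w) => v ev [s ps sv]; apply: nBw.
  by exists (rcons s w); rewrite ?last_rcons // rcons_path ps sv esym.
Qed.

Lemma chain_through y (ys : seq Y) :
  exists2 s, path e y s & forall z, z \in ys -> z \in y :: s.
Proof.
elim: ys y => [|z ys IH] y; first by exists [::].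
have [s ps sz] := chain_between y z; have [s' ps' ys'] := IH z.
exists (s ++ s'); first by rewrite cat_path ps sz.
move=> w; rewrite -cat_cons mem_cat inE => /predU1P [->|/ys'].
  by rewrite -[z in z \in _]sz mem_last.
by rewrite inE => /predU1P [->|->]; rewrite ?orbT // -[z in z \in _]sz mem_last.
Qed.
End Chains.

Section BoxConditions.
Variable R : realType.

Definition in_box (c : seq rat) (e : rat) (v : seq R) : bool :=
  all2 (fun (q : rat) (x : R) => `|x - ratr q| <= ratr e) c v.

Lemma in_boxP (I : eqType) (g : I -> rat) (e : rat) (x : I -> R) (s : seq I) :
  in_box (map g s) e (map x s) <->
  forall i, i \in s -> `|x i - ratr (g i)| <= ratr e.
Proof.
rewrite /in_box; split.
  elim: s => //= i s IH /andP[xi /IH xs] k.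
  by rewrite inE => /predU1P [->|/xs].
elim: s => //= i s IH xs; rewrite xs ?mem_head //=; apply: IH => k ks.
by apply: xs; rewrite inE ks orbT.
Qed.

(** The path with the given coordinates meets, or misses, a closed rational
    box. *)
Definition box_holds (b : bool * seq rat * rat) (paths : seq (seq rat)) : Prop :=
  let inside := exists2 t : R, 0 <= t <= 1 &
    in_box b.1.2 b.2 [seq path_value p t | p <- paths] in
  if b.1.1 then inside else ~ inside.

Lemma interpolate_le (r d A B a b : R) : 0 <= r <= 1 ->
  `|A - a| <= d -> `|B - b| <= d -> `|a - b| <= d ->
  `|(1 - r) * A + r * B - a| <= 2 * d.
Proof.
move=> /andP[r0 r1]; rewrite !ler_norml => /andP[A1 A2] /andP[B1 B2] /andP[a1 a2].
have p1 : 0 <= (1 - r) * (2 * d - (A - a)) by apply: mulr_ge0; lra.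
have p2 : 0 <= (1 - r) * (2 * d + (A - a)) by apply: mulr_ge0; lra.
have p3 : 0 <= r * (2 * d - (B - a)) by apply: mulr_ge0; lra.
have p4 : 0 <= r * (2 * d + (B - a)) by apply: mulr_ge0; lra.
by apply/andP; split; lra.
Qed.

Variables (Y : topologicalType) (I : eqType) (phi : I -> Y -> R).

Definition near_box (y : Y) (g : I -> rat) (s : seq I) (e : R) : Prop :=
  forall i, i \in s -> `|phi i y - ratr (g i)| <= e.

(** The conditions that hold of phi with a margin d, those on meeting a box being
    witnessed by y. *)
Definition margin (d : R) (y : Y) (t : condition (bool * seq rat * rat)%type I)
    : Prop :=
  exists (b : bool) (g : I -> rat) (e : rat), t.1 = (b, map g t.2, e) /\
    if b then near_box y g t.2 (ratr e - d)
    else forall z, ~ near_box z g t.2 (ratr e + d).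

(** The image of phi meets the interior of the box, or misses the box: these are
    the cases in which nearby paths do the same. *)
Definition box_system : set (condition (bool * seq rat * rat)%type I) :=
  [set t | exists (b : bool) (g : I -> rat) (e : rat), t.1 = (b, map g t.2, e) /\
    if b then exists y, forall i, i \in t.2 -> `|phi i y - ratr (g i)| < ratr e
    else forall z, ~ near_box z g t.2 (ratr e)].

Lemma margin_le d d' y t : d' <= d -> margin d y t -> margin d' y t.
Proof.
move=> dd [b [g [e [tE bP]]]]; exists b, g, e; split=> //.
case: b bP {tE} => [near i it|far z near].
  by apply: le_trans (near i it) _; rewrite lerD2l lerN2.
by apply: (far z) => i it; apply: le_trans (near i it) _; rewrite lerD2l.
Qed.

Hypotheses (Ycont : continuum Y) (phic : forall i, continuous (phi i)).

(** When the image of phi misses the box, the margin comes from compactness: a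
    cluster point of points that are closer and closer to the box would be mapped
    into it. *)
Lemma box_system_margin t : box_system t -> exists2 d, 0 < d & exists y, margin d y t.
Proof.
have [[y0 _] Ycomp _ _] := Ycont.
move=> [[] [g [e [tE]]]].
- move=> [y yP]; have : \forall d \near 0^'+,
      forall i, i \in t.2 -> `|phi i y - ratr (g i)| <= ratr e - d.
    apply: filter_all_seq => i it.
    have lt : 0 < ratr e - `|phi i y - ratr (g i)| by rewrite subr_gt0 yP.
    have := nbhs_right_le lt; apply: filterS => d; lra.
  move=> /(filterI (nbhs_right_gt (0 : R))) /filter_ex [d [d0 dP]].
  by exists d => //; exists y, true, g, e.
- move=> far; apply: contrapT => nomargin.
  pose G := filter_from [set d : R | 0 < d]
    (fun d => [set z | near_box z g t.2 (ratr e + d)]).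
  have PG : ProperFilter G.
    apply: filter_from_proper; last first.
      move=> d d0; apply: contrapT => noz; apply: nomargin; exists d => //.
      exists y0, false, g, e; split=> // z zP.
      by apply: noz; exists z.
    apply: filter_from_filter; first by exists 1 => /=.
    move=> d d' /= d0 d'0; exists (Num.min d d'); first by rewrite /= lt_min d0.
    move=> z /= zP; split=> i it; apply: le_trans (zP i it) _;
      by rewrite lerD2l ge_min lexx ?orbT.
  have [|z [_ zG]] := Ycomp G PG; first exact: filterT.
  apply: (far z) => i it; rewrite leNgt; apply/negP => lt.
  pose d := (`|phi i z - ratr (g i)| - ratr e) / 2.
  have d0 : 0 < d by rewrite /d; lra.
  have [||w [/(_ i it) wle]] := zG [set z | near_box z g t.2 (ratr e + d)]
    [set w | ratr e + d < `|phi i w - ratr (g i)|].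
  + by exists d.
  + have cc : continuous (fun w => `|phi i w - ratr (g i)|).
      by move=> w; apply: cvg_norm; apply: cvgB; [exact: phic|exact: cvg_cst].
    apply: open_nbhs_nbhs; split; last by rewrite /= /d; lra.
    by have /continuousP H := cc; have := H _ (@open_gt _ (ratr e + d)).
  + by rewrite /= ltNge wle.
Qed.

Lemma box_system_margins (F : seq (condition (bool * seq rat * rat)%type I)) :
  (forall t, t \in F -> box_system t) ->
  exists2 d, 0 < d & exists ys : seq Y, forall t, t \in F ->
    exists2 y, y \in ys & margin d y t.
Proof.
elim: F => [|t F IH] FT; first by exists 1 => //; exists [::].
have [|d d0 [ys ysP]] := IH; first by move=> s sF; apply: FT; rewrite inE sF orbT.
have [d' d'0 [y yP]] := box_system_margin (FT t (mem_head _ _)).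
exists (Num.min d d'); first by rewrite lt_min d0.
exists (y :: ys) => s; rewrite inE => /predU1P [->|/ysP [z zys zP]].
  by exists y; [exact: mem_head|apply: margin_le yP; rewrite ge_min lexx orbT].
by exists z; [rewrite inE zys orbT|apply: margin_le zP; rewrite ge_min lexx].
Qed.

Hypothesis phi01 : forall i y, 0 <= phi i y <= 1.

(** By connectedness there is a chain of points of Y, with steps small in the
    finitely many coordinates concerned, through all the witnesses.  The polygon
    through rational approximations of its points stays near the image of phi
    and comes near each witness. *)
Lemma box_system_satisfiable (F : seq (condition (bool * seq rat * rat)%type I)) :
  (forall t, t \in F -> box_system t) ->
  exists x : I -> seq rat, holds_all box_holds F x.
Proof.
move=> /box_system_margins [d d0 [ys ysP]].
have [[y0 _] Ycomp Yconn _] := Ycont.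
have d3 : 0 < d / 3 by rewrite divr_gt0.
pose V := indices F.
pose close : rel Y := fun y z =>
  `[< forall i, i \in V -> `|phi i y - phi i z| < d / 3 >].
have close_sym : symmetric close.
  by move=> y z; apply/asboolP/asboolP => yz i /yz; rewrite distrC.
have close_nbhs y : nbhs y [set z | close y z].
  have : nbhs y [set z | forall i, i \in V -> `|phi i y - phi i z| < d / 3].
    apply: filter_all_seq => i _.
    by have /(_ y) /cvgrPdist_lt /(_ _ d3) := @phic i.
  by apply: filterS => z yz; apply/asboolP.
have [s ps sys] := chain_through Yconn close_sym close_nbhs y0 ys.
(* The point y0 is repeated so that the polygon has at least one edge. *)
pose L := [:: y0, y0 & s].
have pL : path close y0 (y0 :: s).
  by rewrite /= ps andbT; apply/asboolP => i _; rewrite subrr normr0.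
have /choice [q qP] : forall iz : I * Y, exists q : rat,
    `|ratr q - phi iz.1 iz.2| <= d / 3.
  move=> [i z]; have [q] := @rat_in_itvoo R (phi i z - d / 3) (phi i z + d / 3)
    ltac:(lra).
  by rewrite in_itv /= => qz; exists q; rewrite ler_norml; lra.
pose x i := [seq q (i, z) | z <- L].
have sizex i : (size (map (ratr : rat -> R) (x i))) = (size s).+2 by rewrite !size_map.
have nthx i k : (k < (size s).+2)%N ->
    nth 0 (map ratr (x i)) k = ratr (q (i, nth y0 L k)) :> R.
  by move=> kL; rewrite /x -map_comp (nth_map y0).
have path_near t : 0 <= t <= 1 -> exists z, forall i, i \in V ->
    `|path_value (x i) t - phi i z| <= d.
  move=> /andP[t0 t1].
  have [||k kN [r r01 rP]] := @polyline_segment R (size s).+1 ((size s).+1%:R * t).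
  - by [].
  - by rewrite mulr_ge0 //= ler_piMr.
  exists (nth y0 L k) => i iV; rewrite /path_value -[phi i _]clamp_id //.
  apply: le_trans (clamp_lipschitz _ _) _.
  rewrite size_map [(size L).-1]/= rP ?sizex // !nthx //; last exact: ltnW.
  have h : `|phi i (nth y0 L k) - phi i (nth y0 L k.+1)| <= d / 3.
    by have /asboolP /(_ i iV) /ltW := pathP y0 pL k kN.
  have := interpolate_le r01 (qP (i, nth y0 L k)) (qP (i, nth y0 L k.+1)) h.
  by move/le_trans; apply; lra.
exists x => t tF; have [y yys [b [g [e [tE bP]]]]] := ysP t tF.
have tV i : i \in t.2 -> i \in V by move=> it; exact: mem_indices it.
rewrite tE /box_holds /=; case: b bP {tE} => [near|far].
- have yL : y \in L by rewrite inE sys ?orbT.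
  have kL : (index y L < (size s).+2)%N by rewrite -[(size s).+2]/(size L) index_mem.
  exists ((index y L)%:R / (size s).+1%:R).
    rewrite divr_ge0 //= ler_pdivrMr ?ltr0Sn // mul1r ler_nat.
    by rewrite -ltnS.
  rewrite -map_comp; apply/in_boxP => i it /=.
  have -> : path_value (x i) ((index y L)%:R / (size s).+1%:R : R) =
        clamp (ratr (q (i, y))).
    rewrite /path_value size_map [(size L).-1]/= mulrCA divff ?pnatr_eq0 // mulr1.
    by rewrite polyline_vertex ?sizex // nthx // nth_index.
  have := near i it; have := le_trans (clamp_lipschitz _ _) (qP (i, y)).
  rewrite /= [clamp (phi i y)]clamp_id // => h1 h2.
  by rewrite -[X in `|X|](subrKA (phi i y)); apply: le_trans (ler_normD _ _) _; lra.
- move=> [r r01]; rewrite -map_comp => /in_boxP rP.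
  have [z zP] := path_near r r01; apply: (far z) => i it.
  have := rP i it; have := zP i (tV i it); rewrite distrC /= => h1 h2.
  rewrite -[X in `|X|](subrKA (path_value (x i) r)).
  by apply: le_trans (ler_normD _ _) _; lra.
Qed.
End BoxConditions.

(** * The map onto a continuum *)

Lemma set_type_at_most_continuum T (B : set T) :
  B #<= continuum_card -> at_most_continuum B.
Proof.
move=> /card_leP [f]; exists (fun x => set_val (f x)) => x y /val_inj e.
by apply: (@inj _ _ _ f) => //; exact/mem_set.
Qed.

Lemma cluster_eq (R : realType) (T : topologicalType) (F : set_system T) (y : T)
    (k : T -> R) (a : R) :
  continuous k -> cluster F y -> (forall e, 0 < e -> F [set z | `|k z - a| <= e]) ->
  k y = a.
Proof.
move=> kc Fy Fk; apply/eqP; rewrite -subr_eq0 -normr_le0 leNgt; apply/negP => lt.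
have e0 : 0 < `|k y - a| / 2 by rewrite divr_gt0.
have [|z [/= le]] := Fy _ [set z | `|k y - a| / 2 < `|k z - a|] (Fk _ e0).
  have cc : continuous (fun z => `|k z - a|).
    by move=> z; apply: cvg_norm; apply: cvgB; [exact: kc|exact: cvg_cst].
  apply: open_nbhs_nbhs; split; last by rewrite /=; lra.
  by have /continuousP H := cc; have := H _ (@open_gt _ (`|k y - a| / 2)).
by rewrite /= ltNge le.
Qed.

Section UrysohnFamily.
Variables (R : realType) (Y : topologicalType) (B : set (set Y)).

(** Only the pairs in which the closure of the first set is contained in the
    second give useful functions; for the others [Urysohn] is still continuous
    with values in the unit interval. *)
Definition urysohn_family (UV : B * B) : Y -> R :=
  Urysohn (closure (set_val UV.1)) (~` set_val UV.2).

Lemma urysohn_family_itv UV y : 0 <= urysohn_family UV y <= 1.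
Proof.
have := @Urysohn_range Y R (closure (set_val UV.1)) (~` set_val UV.2).
by move=> /(_ _ (ex_intro2 _ _ y I erefl)); rewrite /= in_itv.
Qed.

Lemma urysohn_family_separates (y z : Y) :
  compact [set: Y] -> hausdorff_space Y -> basis B ->
  (forall UV, urysohn_family UV y = urysohn_family UV z) -> y = z.
Proof.
move=> cY hY [Bo Bn] yz; apply: contrapT => ne.
have zc : closed [set z].
  exact: (accessible_closed_set1 (hausdorff_accessible hY)).
have ny : nbhs y (~` [set z]).
  by apply: open_nbhs_nbhs; split=> //; exact: closed_openC.
have [V [BV Vy] Vz] := Bn y _ ny.
have [W Wy WV] : exists2 W, nbhs y W & closure W `<=` V.
  apply: (@compact_regular _ y setT hY cY); first exact: filterT.
  by apply: open_nbhs_nbhs; split=> //; exact: Bo.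
have [U [BU Uy] UW] := Bn y W Wy.
have sep : uniform_separator (closure U) (~` V).
  apply: ((@normal_separatorP R Y).1 (compact_normal hY cY)).
  - exact: closed_closure.
  - by apply: open_closedC; exact: Bo.
  - by apply/seteqP; split=> // w [/(closureS UW) /WV].
have := yz (exist _ U (mem_set BU), exist _ V (mem_set BV)).
rewrite /urysohn_family /=.
have -> : Urysohn (closure U) (~` V) y = 0 :> R.
  by apply: (Urysohn_sub0 sep); exists y => //; exact: subset_closure.
have -> : Urysohn (closure U) (~` V) z = 1 :> R.
  by apply: (Urysohn_sub1 sep); exists z => // Vz'; exact: (Vz z Vz').
by move/eqP; rewrite eq_sym oner_eq0.
Qed.
End UrysohnFamily.

Section Coordinates.
Variables (R : realType) (u : set_system nat) (uU : UltraFilter u).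
Variables (Y : topologicalType) (I : choiceType) (phi : I -> Y -> R).
Variable b : I -> nat -> seq rat.
Hypotheses (Ycomp : compact [set: Y]) (phic : forall i, continuous (phi i)).
Hypothesis bP : forall t, box_system phi t ->
  u [set n | box_holds R t.1 [seq b i n | i <- t.2]].
Local Notation iota := (@stone_cech_unit R (MM R)).

Lemma path_continuous i n :
  continuous (fun t : R => polyline (map ratr (b i n)) ((size (b i n)).-1%:R * t)).
Proof.
move=> t; apply: (@continuous_comp _ _ _ (fun t : R => (size (b i n)).-1%:R * t)
  (polyline (map ratr (b i n)))); last exact: polyline_continuous.
by apply: cvgM; [exact: cvg_cst|exact: cvg_id].
Qed.

Definition coordinate i : continuousType (MM R) (unit_interval R) :=
  sheets (@path_continuous i).

Lemma extension_coordinate i n t :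
  extension (coordinate i) (iota (n, t)) = path_value (b i n) (set_val t).
Proof. by []. Qed.

(** Conditions speak of rational boxes only, for the sake of countability; this
    approximates the box of size e around v by a smaller rational one. *)
Lemma rational_centers (v : I -> R) (e : R) : 0 < e ->
  exists2 d : rat, 0 < (ratr d : R) <= e / 2 &
  exists g : I -> rat, forall i, `|v i - ratr (g i)| < ratr d / 2.
Proof.
move=> e0; have e20 : 0 < e / 2 by rewrite divr_gt0.
have [d] := rat_in_itvoo e20.
rewrite in_itv /= => /andP[d0 de]; exists d; first by rewrite d0 ltW.
have /choice [g gP] : forall i, exists q : rat, `|v i - ratr q| < ratr d / 2.
  move=> i; have lt : v i - ratr d / 2 < v i + ratr d / 2 by lra.
  have [q] := rat_in_itvoo lt.
  by rewrite in_itv /= => /andP[q1 q2]; exists q; rewrite ltr_norml; lra.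
by exists g.
Qed.

(** If no point of Y had nearly the coordinates of p, then the image of phi would
    miss a box around them, and so would almost all paths, although p is a limit
    of points of these paths. *)
Lemma coordinates_in_image (p : II R u) :
  exists y, forall i, phi i y = extension (coordinate i) (set_val p).
Proof.
pose v i := extension (coordinate i) (set_val p).
pose G := filter_from [set se : seq I * R | 0 < se.2]
  (fun se => [set y | forall i, i \in se.1 -> `|phi i y - v i| <= se.2]).
have PG : ProperFilter G.
  apply: filter_from_proper; first apply: filter_from_filter.
  - by exists ([::], 1) => /=.
  - move=> [s e] [s' e'] /= e0 e'0; exists (s ++ s', Num.min e e').
      by rewrite /= lt_min e0.
    move=> y yP; split=> i is_; apply: le_trans (yP i _) _;
      rewrite ?mem_cat ?is_ ?orbT //; by rewrite /= ge_min lexx ?orbT.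
  move=> [s e] /= e0; apply: contrapT => noy.
  have [d /andP[d0 de] [g gP]] := rational_centers v e0.
  have /bP uU' : box_system phi ((false, map g s, d), s).
    exists false, g, d; split=> // y yP; apply: noy; exists y => i is_.
    rewrite -[X in `|X|](subrKA (ratr (g i))); apply: le_trans (ler_normD _ _) _.
    by have := yP i is_; have := gP i; rewrite distrC; lra.
  have : nbhs (set_val p) [set q | forall i, i \in s ->
      `|v i - extension (coordinate i) q| < ratr d / 2].
    apply: filter_all_seq => i _.
    have /(_ (set_val p)) /cvgrPdist_lt :=
      @extension_continuous R (MM R) (coordinate i).
    by apply; lra.
  move=> /(II_closure uU') [_ [[[n t] [/= noin _] <-] near]].
  apply: noin; exists (set_val t); first exact: unit_itv.
  rewrite -map_comp; apply/in_boxP => i is_ /=.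
  have := near i is_; rewrite extension_coordinate distrC => h.
  rewrite -[X in `|X|](subrKA (v i)); apply: le_trans (ler_normD _ _) _.
  by have := gP i; lra.
have [|y [_ yG]] := Ycomp PG; first exact: filterT.
exists y => i; apply: cluster_eq yG _; first exact: (@phic i).
by move=> e e0; exists ([:: i], e) => // z; apply; exact: mem_head.
Qed.

(** Almost all paths meet any given box around the image of y, and p is a cluster
    point of the points where they do so. *)
Lemma image_in_coordinates (y : Y) :
  exists p : II R u, forall i, extension (coordinate i) (set_val p) = phi i y.
Proof.
pose G := filter_from [set Use : set nat * (seq I * R) | u Use.1 /\ 0 < Use.2.2]
  (fun Use => [set iota nt | nt in [set nt | Use.1 nt.1 /\ forall i, i \in Use.2.1 ->
     `|extension (coordinate i) (iota nt) - phi i y| <= Use.2.2]]).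
have PG : ProperFilter G.
  apply: filter_from_proper; first apply: filter_from_filter.
  - by exists (setT, ([::], 1)); split=> //=; exact: filterT.
  - move=> [U [s e]] [U' [s' e']] /= [uU1 e0] [uU2 e'0].
    exists (U `&` U', (s ++ s', Num.min e e')).
      by split; [exact: filterI|rewrite /= lt_min e0].
    move=> _ [nt [[/= U1 U2] ntP] <-]; split; exists nt => //; split=> // i is_;
      apply: le_trans (ntP i _) _; rewrite ?mem_cat ?is_ ?orbT //;
      by rewrite ge_min lexx ?orbT.
  move=> [U [s e]] /= [uU' e0].
  have [d /andP[d0 de] [g gP]] := rational_centers (phi^~ y) e0.
  have /bP uin : box_system phi ((true, map g s, d), s).
    by exists true, g, d; split=> //; exists y => i _; apply: lt_le_trans (gP i) _; lra.
  have [n [/= Un [t t01]]] := filter_ex (filterI uU' uin).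
  rewrite -map_comp => /in_boxP tP.
  exists (iota (n, to_unit t)), (n, to_unit t) => //; split=> // i is_.
  rewrite extension_coordinate [set_val _]clamp_id //.
  rewrite -[X in `|X|](subrKA (ratr (g i))); apply: le_trans (ler_normD _ _) _.
  by have := gP i; have := tP i is_ ; rewrite /= [in X in _ -> X -> _]distrC; lra.
have [|p pG] := @cluster_II R u _ PG.
  move=> U uU'; exists (U, ([::], 1)); first by split=> /=.
  by move=> _ [nt [Unt _] <-]; exists nt.
exists p => i; apply: cluster_eq pG _; first exact: extension_continuous.
move=> e e0; exists (setT, ([:: i], e)); first by split=> //=; exact: filterT.
by move=> _ [nt [_ /(_ i (mem_head _ _)) ntP] <-].
Qed.

(** The choice of f p is unique since phi separates points.  Continuity follows
    from the compactness of Y, as f p is the only possible cluster point of f at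
    p. *)
Lemma coordinates_onto : hausdorff_space Y ->
  (forall y z, (forall i, phi i y = phi i z) -> y = z) ->
  exists f : II R u -> Y, continuous f /\ range f = [set: Y].
Proof.
move=> hY sep; have /choice [f fP] := coordinates_in_image.
exists f; split; last first.
  apply/seteqP; split=> // y _; have [p pP] := image_in_coordinates y.
  by exists p => //; apply: sep => i; rewrite fP pP.
move=> p; have cl z : cluster (f @ p) z -> z = f p.
  move=> zcl; apply: sep => i; rewrite fP.
  apply: (cluster_eq (@phic i) zcl) => e e0.
  have /(_ p) /cvgrPdist_le /(_ _ e0) := @extension_II_continuous R u (coordinate i).
  by apply: (@filterS _ (nbhs p)) => q; rewrite /= fP distrC.
have Ff : ProperFilter (f @ p) by exact: (fmap_proper_filter f (nbhs_pfilter p)).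
have clE : cluster (f @ p) = [set f p].
  apply/seteqP; split=> [z /cl //|_ ->].
  have [|z [_ zcl]] := @Ycomp (f @ p) Ff; first exact: (@filterT _ (nbhs p)).
  by rewrite -(cl z zcl).
by apply: (@compact_cluster_set1 _ (f p) (f @ p) setT hY Ycomp) => //;
  [exact: filterT|exact: (@filterT _ (nbhs p))].
Qed.
End Coordinates.

Theorem mainTheorem6 (R : realType) (u : set_system nat)
    (hu : continuum_saturated_ultrafilter u) :
  [/\ continuum (II R u),
      weight_eq (II R u) continuum_card &
      forall Y : topologicalType, continuum Y -> weight_le Y continuum_card ->
        exists f : II R u -> Y, continuous f /\ range f = [set: Y]].
Proof.
have [uU _] := hu; split; first exact: II_continuum.
  by apply: II_weight => N; exact: saturated_ultrafilter_nonprincipal.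
move=> Y Ycont [B Bbasis Bcard]; have [_ Ycomp _ Yhaus] := Ycont.
have [code codei] : at_most_continuum (B * B).
  by apply: pair_at_most_continuum; exact: set_type_at_most_continuum.
have phic (i : B * B) : continuous (@urysohn_family R Y B i).
  exact: Urysohn_continuous.
have [||||b bP] := @realize_conditions u (seq rat) (bool * seq rat * rat)%type
  (box_holds R) (B * B)%type code (box_system (@urysohn_family R Y B)) hu.
- by split; exact: [::].
- exact: countableP.
- exact: codei.
- apply: box_system_satisfiable => //; exact: urysohn_family_itv.
apply: (coordinates_onto uU Ycomp phic bP Yhaus) => y z.
exact: urysohn_family_separates.
Qed.
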